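(* The second cohomology group of $\mathcal{L}(\Gamma)$ is $$H^2(\mathcal{L}(\Gamma),\mathbb{C})=\prod_{\substack{k\in\mathbb{Z}\\ x\in X}}\mathbb{C}\,\overline{\phi}_{k,x},\qquad X=\{1,2,3\},$$ the direct product of all the $\mathbb{C}\overline{\phi}_{k,x}$, where $\overline{\phi}_{k,x}$ is the cohomology class of the second cocycle $\phi_{k,x}$ defined, for $\alpha,\beta\in\Gamma$ and $i,j\in\mathbb{Z}$, by $$\phi_{k,1}(L_{\alpha,i},L_{\beta,j})=\delta_{\alpha+\beta,0}\,\delta_{i+j,k}\,\frac{\alpha^3-\alpha}{12},$$ $$\phi_{k,2}(L_{\alpha,i},H_{\beta,j})=\delta_{\alpha+\beta,0}\,\delta_{i+j,k}\,(\alpha^2-\alpha),$$ $$\phi_{k,3}(H_{\alpha,i},H_{\beta,j})=\delta_{\alpha+\beta,0}\,\delta_{i+j,k}\,\alpha .$$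
   Context: The ground field is $\mathbb{C}$. $\Gamma$ is an additive subgroup of $\mathbb{C}$ containing $1$ (so $\mathbb{Z}\subseteq\Gamma$). The generalized loop Heisenberg-Virasoro algebra $\mathcal{L}(\Gamma)$ is the complex Lie algebra with basis $\{L_{\alpha,i},H_{\beta,j}\mid \alpha,\beta\in\Gamma,\ i,j\in\mathbb{Z}\}$ and brackets $$[L_{\alpha,i},L_{\beta,j}]=(\alpha-\beta)L_{\alpha+\beta,i+j},\quad [L_{\alpha,i},H_{\beta,j}]=-\beta H_{\alpha+\beta,i+j},\quad [H_{\alpha,i},H_{\beta,j}]=0.$$ A second cocycle on a Lie algebra $\mathcal{L}$ is a bilinear form $\psi:\mathcal{L}\times\mathcal{L}\to\mathbb{C}$ with $\psi(x,y)=-\psi(y,x)$ and $\psi(x,[y,z])+\psi(y,[z,x])+\psi(z,[x,y])=0$ for all $x,y,z\in\mathcal{L}$; $C^2(\mathcal{L},\mathbb{C})$ is the vector space of these. For a linear function $f:\mathcal{L}\to\mathbb{C}$, the second cocycle $\psi_f(x,y)=f([x,y])$ is called a second coboundary; $B^2(\mathcal{L},\mathbb{C})$ is the vector space of these. $H^2(\mathcal{L},\mathbb{C})=C^2(\mathcal{L},\mathbb{C})/B^2(\mathcal{L},\mathbb{C})$. $\delta_{i,j}$ is $1$ if $i=j$ and $0$ otherwise. Each $\phi_{k,x}$ is the skew-symmetric bilinear form with the given values, and is zero on all pairs of basis elements whose value is not determined by the given formula and skew-symmetry. An element $(c_{k,x})$ of the direct product corresponds to the class of the (pointwise finite) sum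 $\sum_{k,x}c_{k,x}\phi_{k,x}$. *)

(* Defs.v *)
From HB Require Import structures.
From mathcomp Require Import all_boot all_order all_algebra.
From mathcomp Require Import finmap.
From mathcomp Require Import boolp classical_sets functions cardinality fsbigop reals.
From mathcomp Require Import complex.
From mathcomp Require Import monalg.
From mathcomp Require Import ring.

Set Implicit Arguments.
Unset Strict Implicit.
Unset Printing Implicit Defensive.

Import GRing.Theory Num.Theory.
Local Open Scope ring_scope.
Local Open Scope complex_scope.

HB.mixin Record Lmodule_isLie (F : fieldType) L of GRing.Lmodule F L := {
  lie : L -> L -> L;
  lie_linearl : forall y, linear (lie^~ y);
  lie_linearr : forall x, linear (lie x);
  liexx : forall x, lie x x = 0;
  lie_jacobi : forall x y z,
    lie x (lie y z) + lie y (lie z x) + lie z (lie x y) = 0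
}.

#[short(type="lieAlgType")]
HB.structure Definition LieAlgebra (F : fieldType) :=
  { L of Lmodule_isLie F L & GRing.Lmodule F L }.

Section Cohomology.
Variables (F : fieldType) (L : lieAlgType F).

Definition is_cocycle (psi : L -> L -> F^o) : Prop :=
  [/\ forall y, linear (psi^~ y),
      forall x, linear (psi x),
      forall x y, psi x y = - psi y x
    & forall x y z,
        psi x (lie y z) + psi y (lie z x) + psi z (lie x y) = 0].

Definition cocycle_pred : {pred L -> L -> F^o} :=
  fun psi => `[< is_cocycle psi >].

Lemma cocycle_submod_closed : submod_closed cocycle_pred.
Proof.
split.
  apply/asboolP.
  have E x y : (0 : L -> L -> F^o) x y = 0 by [].
  by split=> [y a u v|y a u v|x y|x y z] /=; rewrite !E ?scaler0 ?addr0 ?oppr0.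
move=> a p q /asboolP[pl pr pa pj] /asboolP[ql qr qa qj].
have E x y : (a *: p + q : L -> L -> F^o) x y = a *: p x y + q x y by [].
apply/asboolP; split.
- move=> y b u v; rewrite /= !E pl ql !scalerDr !scalerA (mulrC a b).
  by rewrite addrACA.
- move=> y b u v; rewrite /= !E pr qr !scalerDr !scalerA (mulrC a b).
  by rewrite addrACA.
- by move=> x y; rewrite !E pa qa scalerN opprD.
- move=> x y z; rewrite !E.
  rewrite (addrACA (a *: p x _)) [LHS]addrACA qj addr0.
  by rewrite -[RHS](scaler0 _ a) -(pj x y z) !scalerDr.
Qed.

HB.instance Definition _ := GRing.isSubmodClosed.Build F (L -> L -> F^o)
  cocycle_pred cocycle_submod_closed.

Record C2 := MkC2 { C2_val :> L -> L -> F^o; C2_valP : C2_val \in cocycle_pred }.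
HB.instance Definition _ := [isSub for C2_val].
HB.instance Definition _ := [Choice of C2 by <:].
HB.instance Definition _ := [SubChoice_isSubLmodule of C2 by <:].

Definition cocycle (psi : L -> L -> F^o) (h : is_cocycle psi) : C2 :=
  MkC2 (asboolT h).

Definition is_coboundary (psi : C2) : Prop :=
  exists2 f : L -> F^o, linear f & forall x y, psi x y = f (lie x y).

Definition B2 : {pred C2} := fun psi => `[< is_coboundary psi >].

Lemma B2_submod_closed : submod_closed B2.
Proof.
split.
  apply/asboolP; exists (fun=> 0) => //.
  by move=> a u v; rewrite scaler0 addr0.
move=> a p q /asboolP[f fl fE] /asboolP[g gl gE].
apply/asboolP; exists (fun x => a *: f x + g x).
  move=> b u v; rewrite fl gl !scalerDr !scalerA (mulrC a b).
  by rewrite addrACA.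
by move=> x y; rewrite /= !fctE fE gE.
Qed.

HB.instance Definition _ := GRing.isSubmodClosed.Build F C2 B2 B2_submod_closed.

Definition H2 := Quotient.quot B2.
HB.instance Definition _ := GRing.Zmodule.on H2.

Definition H2_class (psi : C2) : H2 := (\pi_(Quotient.quot B2) psi)%qT.

Definition H2_scale (a : F) (q : H2) : H2 := H2_class (a *: repr q).

Lemma H2_classE p q : (H2_class p = H2_class q) <-> p - q \in B2.
Proof. by split=> [/eqP|h]; [|apply/eqP]; rewrite -Quotient.idealrBE. Qed.

Lemma H2_classK q : H2_class (repr q) = q. Proof. exact: reprK. Qed.

Lemma H2_classD p q : H2_class (p + q) = H2_class p + H2_class q.
Proof. by rewrite /H2_class raddfD. Qed.

Lemma H2_scale_class a p : H2_scale a (H2_class p) = H2_class (a *: p).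
Proof.
apply/H2_classE; rewrite -scalerBr; apply: rpredZ.
by apply/H2_classE; rewrite H2_classK.
Qed.

Lemma H2_scaleA a b q : H2_scale a (H2_scale b q) = H2_scale (a * b) q.
Proof. by rewrite -(H2_classK q) !H2_scale_class scalerA. Qed.
Lemma H2_scale1 : left_id 1 H2_scale.
Proof. by move=> q; rewrite -(H2_classK q) H2_scale_class scale1r. Qed.
Lemma H2_scaleDr : right_distributive H2_scale +%R.
Proof.
move=> a p q; rewrite -(H2_classK q) -(H2_classK p) -H2_classD.
by rewrite !H2_scale_class scalerDr H2_classD.
Qed.
Lemma H2_scaleDl q : {morph H2_scale^~ q : a b / a + b}.
Proof.
by move=> a b; rewrite -(H2_classK q) !H2_scale_class scalerDl H2_classD.
Qed.

HB.instance Definition _ := GRing.Zmodule_isLmodule.Build F H2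
  H2_scaleA H2_scale1 H2_scaleDr H2_scaleDl.

End Cohomology.

Section FreeModule.
Variables (F : fieldType) (K : choiceType).
Implicit Types u v w : {malg F[K]}.

Lemma malg_linear0 (V : lmodType F) (f : {malg F[K]} -> V) :
  linear f -> (forall k, f << k >> = 0) -> forall u, f u = 0.
Proof.
move=> fl f0.
have f00 : f 0 = 0.
  by move: (fl (-1) 0 0); rewrite !scaleN1r oppr0 add0r addNr.
move=> u; rewrite (monalgE u).
elim/big_ind: _ => // [x y hx hy|k _].
  by move: (fl 1 x y); rewrite !scale1r hx hy addr0.
have -> : << u@_k *g k >> = u@_k *: << k >> + 0 :> {malg F[K]}.
  by rewrite addr0; apply/malgP => k'; rewrite mcoeffZ !mcoeffU mulrnAr mulr1.
by rewrite fl f0 f00 scaler0 addr0.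
Qed.

Definition bilin_ext (V : lmodType F) (f : K -> K -> V) u v : V :=
  \sum_(a <- msupp u) \sum_(b <- msupp v) (u@_a * v@_b) *: f a b.

Variables (V : lmodType F) (f : K -> K -> V).

Lemma bilin_extE (A B : {fset K}) u v :
  (msupp u `<=` A)%fset -> (msupp v `<=` B)%fset ->
  bilin_ext f u v = \sum_(a <- A) \sum_(b <- B) (u@_a * v@_b) *: f a b.
Proof.
move=> sA sB; rewrite /bilin_ext (big_fset_incl _ sA) /=; last first.
  move=> a _ /mcoeff_outdom ->; rewrite big1 // => b _.
  by rewrite mul0r scale0r.
apply: eq_bigr => a _; apply: big_fset_incl => // b _ /mcoeff_outdom ->.
by rewrite mulr0 scale0r.
Qed.

Lemma bilin_ext_linearl v : linear (bilin_ext f ^~ v).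
Proof.
move=> c u w /=.
set A := (msupp u `|` msupp w)%fset.
have sw : (msupp w `<=` A)%fset by apply: fsubsetUr.
have su : (msupp u `<=` A)%fset by apply: fsubsetUl.
have sc : (msupp (c *: u + w) `<=` A)%fset.
  by apply: fsubset_trans (msuppD_le _ _) _; apply: fsetSU; apply: msuppZ_le.
rewrite (bilin_extE sc (fsubset_refl _)) (bilin_extE su (fsubset_refl _)).
rewrite (bilin_extE sw (fsubset_refl _)) scaler_sumr -big_split.
apply: eq_bigr => a _; rewrite scaler_sumr -big_split; apply: eq_bigr => b _ /=.
by rewrite mcoeffD mcoeffZ mulrDl -mulrA scalerDl scalerA.
Qed.

Lemma bilin_ext_linearr u : linear (bilin_ext f u).
Proof.
move=> c v w /=.
set A := (msupp v `|` msupp w)%fset.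
have sw : (msupp w `<=` A)%fset by apply: fsubsetUr.
have sv : (msupp v `<=` A)%fset by apply: fsubsetUl.
have sc : (msupp (c *: v + w) `<=` A)%fset.
  by apply: fsubset_trans (msuppD_le _ _) _; apply: fsetSU; apply: msuppZ_le.
rewrite (bilin_extE (fsubset_refl _) sc) (bilin_extE (fsubset_refl _) sv).
rewrite (bilin_extE (fsubset_refl _) sw) scaler_sumr -big_split.
apply: eq_bigr => a _; rewrite scaler_sumr -big_split; apply: eq_bigr => b _ /=.
by rewrite mcoeffD mcoeffZ mulrDr mulrCA scalerDl scalerA.
Qed.

Lemma bilin_extU a b : bilin_ext f << a >> << b >> = f a b.
Proof.
have s (k : K) : (msupp (<< k >> : {malg F[K]}) `<=` [fset k])%fset.
  exact: msuppU_le.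
by rewrite (bilin_extE (s a) (s b)) !big_seq_fset1 !mcoeffUU mulr1 scale1r.
Qed.

End FreeModule.

Section LoopHeisenbergVirasoro.
Variables (R : realType) (G : zmodClosed R[i]).

(* The subgroup [G] as a type. *)
Record gam := Gam { gam_val :> R[i]; gam_valP : gam_val \in G }.
HB.instance Definition _ := [isSub for gam_val].
HB.instance Definition _ := [Choice of gam by <:].
HB.instance Definition _ := [SubChoice_isSubZmodule of gam by <:].

Variant hv_basis := Lb of gam & int | Hb of gam & int.

Definition hv_code (a : hv_basis) : (gam * int) + (gam * int) :=
  match a with Lb x i => inl (x, i) | Hb x i => inr (x, i) end.
Definition hv_decode (s : (gam * int) + (gam * int)) : hv_basis :=
  match s with inl p => Lb p.1 p.2 | inr p => Hb p.1 p.2 end.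
Lemma hv_codeK : cancel hv_code hv_decode. Proof. by case. Qed.
HB.instance Definition _ := Choice.copy hv_basis (can_type hv_codeK).

(* The free module on the symbols L_(alpha, i), H_(beta, j). *)
Definition loopHV := {malg R[i][hv_basis]}.
HB.instance Definition _ := GRing.Lmodule.on loopHV.

Definition hv_bracket (a b : hv_basis) : loopHV :=
  match a, b with
  | Lb x i, Lb y j => (gam_val x - gam_val y) *: << Lb (x + y) (i + j) >>
  | Lb x i, Hb y j => - gam_val y *: << Hb (x + y) (i + j) >>
  | Hb x i, Lb y j => gam_val x *: << Hb (x + y) (i + j) >>
  | Hb _ _, Hb _ _ => 0
  end.

Definition hv_lie : loopHV -> loopHV -> loopHV := bilin_ext hv_bracket.

Lemma hv_lieU a b : hv_lie << a >> << b >> = hv_bracket a b.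
Proof. exact: bilin_extU. Qed.

Lemma hv_lie_linearl y : linear (hv_lie^~ y).
Proof. exact: bilin_ext_linearl. Qed.

Lemma hv_lie_linearr x : linear (hv_lie x).
Proof. exact: bilin_ext_linearr. Qed.

Lemma hv_bracketC a b : hv_bracket a b = - hv_bracket b a.
Proof.
case: a b => [x i|x i] [y j|y j] /=; last by rewrite oppr0.
- by rewrite (addrC y x) (addrC j i) -scaleNr opprB.
- by rewrite (addrC y x) (addrC j i) -scaleNr.
- by rewrite (addrC y x) (addrC j i) -scaleNr opprK.
Qed.

Lemma hv_lieC x y : hv_lie x y = - hv_lie y x.
Proof.
apply/eqP; rewrite -addr_eq0; apply/eqP.
move: x; apply: malg_linear0.
  move=> c u v; rewrite hv_lie_linearl hv_lie_linearr scalerDr.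
  by rewrite addrACA.
move=> a; move: y; apply: malg_linear0.
  move=> c u v; rewrite hv_lie_linearl hv_lie_linearr scalerDr.
  by rewrite addrACA.
by move=> b; rewrite !hv_lieU hv_bracketC addNr.
Qed.

Lemma hv_liexx x : hv_lie x x = 0.
Proof.
have /eqP := hv_lieC x x.
rewrite -addr_eq0 -mulr2n -scaler_nat scaler_eq0 pnatr_eq0 /=.
by move/eqP.
Qed.

(* Jacobi is checked over an abstract module [V], where failed unifications do
   not unfold the finitely supported functions underlying [loopHV]. *)
Let bracket_in (V : lmodType R[i]) (e : hv_basis -> V) (a b : hv_basis) : V :=
  match a, b with
  | Lb x i, Lb y j => (gam_val x - gam_val y) *: e (Lb (x + y) (i + j))
  | Lb x i, Hb y j => - gam_val y *: e (Hb (x + y) (i + j))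
  | Hb x i, Lb y j => gam_val x *: e (Hb (x + y) (i + j))
  | Hb _ _, Hb _ _ => 0
  end.

Let hv_jacobi_basis (V : lmodType R[i]) (e : hv_basis -> V) (l : V -> V -> V)
    (zb : forall c p q, l (e p) (c *: e q) = c *: bracket_in e p q)
    (l0 : forall u, l u 0 = 0) a b d :
  l (e a) (bracket_in e b d) + l (e b) (bracket_in e d a)
    + l (e d) (bracket_in e a b) = 0.
Proof.
have zh c x i y j : l (e (Hb x i)) (c *: e (Hb y j)) = 0.
  by rewrite zb scaler0.
have rot (M : zmodType) (p q r : M) :
    (q + (r + p) = p + (q + r)) * (r + (p + q) = p + (q + r)).
  by split; [rewrite addrA addrC | rewrite addrC addrA].
have vD (p q : gam) : gam_val (p + q) = gam_val p + gam_val q by [].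
have fin (c1 c2 c3 : R[i]) (v : V) :
    c1 + c2 + c3 = 0 -> c1 *: v + c2 *: v + c3 *: v = 0.
  by move=> h; rewrite -!scalerDl h scale0r.
have [gx gy] := (rot gam, rot int).
case: a b d => [x i|x i] [y j|y j] [z k|z k]; rewrite /bracket_in.
- rewrite 3!zb /bracket_in 3!scalerA !(gx x y z) !(gy i j k).
  by apply: fin; rewrite !vD; ring.
- rewrite 3!zb /bracket_in 3!scalerA !(gx x y z) !(gy i j k).
  by apply: fin; rewrite !vD; ring.
- rewrite 3!zb /bracket_in 3!scalerA !(gx x y z) !(gy i j k).
  by apply: fin; rewrite !vD; ring.
- by rewrite l0 2!zh !addr0.
- rewrite 3!zb /bracket_in 3!scalerA !(gx x y z) !(gy i j k).
  by apply: fin; rewrite !vD; ring.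
- by rewrite l0 2!zh !addr0.
- by rewrite l0 2!zh !addr0.
- by rewrite 3!l0 !addr0.
Qed.

Lemma hv_jacobi x y z :
  hv_lie x (hv_lie y z) + hv_lie y (hv_lie z x) + hv_lie z (hv_lie x y) = 0.
Proof.
have ll c u v w : hv_lie (c *: u + v) w = c *: hv_lie u w + hv_lie v w.
  exact: hv_lie_linearl.
have lr c u v w : hv_lie w (c *: u + v) = c *: hv_lie w u + hv_lie w v.
  exact: hv_lie_linearr.
have aca (c : R[i]) (p q r p' q' r' : loopHV) :
    (c *: p + p') + (c *: q + q') + (c *: r + r') =
    c *: (p + q + r) + (p' + q' + r').
  by rewrite (addrACA (c *: p)) [LHS]addrACA !scalerDr.
have l0 u : hv_lie u 0 = 0.
  by have := lr (-1) 0 0 u; rewrite !scaleN1r oppr0 addr0 addNr.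
have zr (c : R[i]) u v : hv_lie v (c *: u) = c *: hv_lie v u.
  by rewrite -[c *: u]addr0 lr l0 addr0.
move: x; apply: malg_linear0 => [c u v|a].
  by rewrite 2!ll 3!lr aca.
move: y; apply: malg_linear0 => [c u v|b].
  by rewrite 2!ll 3!lr aca.
move: z; apply: malg_linear0 => [c u v|d].
  by rewrite 2!ll 3!lr aca.
rewrite !hv_lieU.
have zb c p q : hv_lie << p >> (c *: << q >>) = c *: hv_bracket p q.
  by rewrite zr hv_lieU.
exact: (hv_jacobi_basis zb l0).
Qed.

HB.instance Definition _ := Lmodule_isLie.Build R[i] loopHV
  hv_lie_linearl hv_lie_linearr hv_liexx hv_jacobi.

Definition delta (T : eqType) (x y : T) : R[i] := (x == y)%:R.

(* [x : 'I_3] stands for the element [x.+1] of {1, 2, 3}. *)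
Definition phi_basis (k : int) (x : 'I_3) (a b : hv_basis) : R[i]^o :=
  match (val x).+1, a, b with
  | 1, Lb al i, Lb be j =>
      delta (al + be) 0 * delta (i + j) k
        * ((gam_val al ^+ 3 - gam_val al) / 12)
  | 2, Lb al i, Hb be j =>
      delta (al + be) 0 * delta (i + j) k * (gam_val al ^+ 2 - gam_val al)
  | 2, Hb be j, Lb al i =>
      - (delta (al + be) 0 * delta (i + j) k * (gam_val al ^+ 2 - gam_val al))
  | 3, Hb al i, Hb be j => delta (al + be) 0 * delta (i + j) k * gam_val al
  | _, _, _ => 0
  end.

Definition phi (k : int) (x : 'I_3) : loopHV -> loopHV -> R[i]^o :=
  bilin_ext (phi_basis k x).

Lemma phiU k x a b : phi k x << a >> << b >> = phi_basis k x a b.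
Proof. exact: bilin_extU. Qed.

(* [\sum_(_ \in _)] is 0 on an infinite support. *)
Definition phi_sum (c : int * 'I_3 -> R[i]^o) : loopHV -> loopHV -> R[i]^o :=
  fun u v => \sum_(kx \in [set: int * 'I_3]) c kx * phi kx.1 kx.2 u v.

End LoopHeisenbergVirasoro.

(* Main.v *)
Require Import Defs.
From mathcomp Require Import all_boot all_order all_algebra.
From mathcomp Require Import finmap.
From mathcomp Require Import boolp classical_sets functions cardinality fsbigop reals.
From mathcomp Require Import complex.
From mathcomp Require Import monalg.
From mathcomp Require Import ring.

Import GRing.Theory Num.Theory.
Local Open Scope ring_scope.
Local Open Scope complex_scope.

Set Implicit Arguments.
Unset Strict Implicit.
Unset Printing Implicit Defensive.

(** Bilinear forms on the algebra are determined by their values on pairs of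
basis vectors, so everything is read off there.

The forms are cocycles: the Jacobi identity on three basis vectors has the
factor [c (n, x)], where [n] is the total loop degree, in all of its terms, and
what remains is a polynomial identity in the weights.  For the same reason a
family [c] of coefficients, one for each degree, gives a cocycle [phi_sum c]
just as a single [phi k x] does; the infinite sum makes sense because a pair of
basis vectors only meets the [phi k x] with [k] its total degree.

Surjectivity is where the content lies.  Fix a cocycle [psi] and let [e] be the
element 1 of the subgroup.  Every basis vector is a multiple of a bracket,
either with [L_(0,0)] (nonzero weight) or of [L_(e,0)] with a vector of weight
[- e] (weight zero), and subtracting a suitable coboundary kills [psi] on these
brackets.  After that
- the Jacobi identity with [L_(0,0)] shows that [psi] lives on pairs of opposite
  weights ([normalized_weight]);
- on such pairs of fixed total degree [n], the identity becomes a functional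
  equation for functions [g a i] of a weight and a loop degree.  For two vectors
  [H] it says at once that [g] is linear in the weight ([heisenberg_rigidity]).
  In the other cases the normalization gives [g e 0 = 0], the substitution
  [a = b = e] spreads this to all of [g e], [b = 0] then makes [g] independent of
  [i], and shifting the weight by [e] and [e + e] (or by [e] and [- e]) leaves a
  one-parameter family of polynomials in the weight ([virasoro_rigidity],
  [mixed_rigidity]).
So the normalized cocycle is a [phi_sum] ([normalizedE]).

Injectivity: a coboundary of [f] on two pairs with bracket in the same line, say
[L_(2,0), L_(-2,k)] and [L_(1,0), L_(-1,k)], has proportional values, whereas
the form built on [alpha ^ 3 - alpha] vanishes on the second but not on the
first; similarly for the form built on [alpha ^ 2 - alpha], and the third form is
nonzero on pairs of commuting vectors ([phi_sum_basis_inj]). *)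

(** * The functional equations satisfied by a normalized cocycle *)

Section Rigidity.
Variables (F : numFieldType) (V : zmodType) (v : {additive V -> F}) (e : V).
Hypotheses (v_inj : injective v) (ve : v e = 1).

Let vD x y : v (x + y) = v x + v y. Proof. exact: raddfD. Qed.

(** With [g (a + e)] and [g (a + e + e)] eliminated from the instances
[(a, e)], [(a + e, e)] and [(a, e + e)] of the equation, the coefficient of
[g a] becomes the constant 12; no division by a weight is needed, so the formula
holds at every [a]. *)
Lemma virasoro_rigidity (g : V -> int -> F) :
  g e 0 = 0 ->
  (forall a b i j, (v a + 2 * v b) * g a i - (2 * v a + v b) * g b j
                   = (v a - v b) * g (a + b) (i + j)) ->
  forall a i, g a i = (v a ^+ 3 - v a) / 6 * g (e + e) 0.
Proof.
move=> ge0 gE.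
have ge i : g e i = 0.
  have := gE e e i 0; rewrite ge0 ve subrr mul0r mulr0 subr0 => /eqP.
  by rewrite mulf_eq0 mulr1 -(natrD _ 1 2) pnatr_eq0 => /eqP.
have g0 j : g 0 j = 0.
  have := gE e 0 0 j; rewrite addr0 !ge raddf0 ve !mulr0 sub0r mulr1 addr0.
  by move=> /eqP; rewrite oppr_eq0 mulf_eq0 pnatr_eq0 => /eqP.
have gi a i : g a i = g a 0.
  have [->|a0] := eqVneq a 0; first by rewrite !g0.
  have va0 : v a != 0 by rewrite -(raddf0 v) (inj_eq v_inj).
  have := gE a 0 0 i; rewrite g0 raddf0 !mulr0 !addr0 !subr0 add0r.
  by move/(mulfI va0).
move=> a i; rewrite gi.
have h1 := gE a e 0 0; have h2 := gE a (e + e) 0 0.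
have h3 := gE (a + e) e 0 0.
rewrite addr0 ge !vD ve in h1 h2 h3; rewrite (addrA a) in h2.
set p := g a 0 in h1 h2 *; set q := g (a + e) 0 in h1 h3.
set r := g (a + e + e) 0 in h2 h3; set s := g (e + e) 0 in h2 *.
(* The combination of the three instances that cancels q and r. *)
have h : 12 * p = 2 * (v a ^+ 3 - v a) * s.
  apply/eqP; rewrite -subr_eq0; apply/eqP.
  transitivity
    (v a * (v a - 1) * (((v a + 2 * (1 + 1)) * p - (2 * v a + (1 + 1)) * s)
                        - (v a - (1 + 1)) * r)
     - (v a - 2) * (v a - 1) * (((v a + 1 + 2 * 1) * q
                                 - (2 * (v a + 1) + 1) * 0) - (v a + 1 - 1) * r)
     - (v a - 2) * (v a + 3) * (((v a + 2 * 1) * p - (2 * v a + 1) * 0)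
                                - (v a - 1) * q)); first by ring.
  by rewrite h1 h2 h3 !subrr !mulr0 !subr0.
have -> : p = 12 * p / 12 by field.
by rewrite h; field.
Qed.

(** As before, the instances [(a, e)] and [(a + e, - e)] suffice to eliminate
[p (a + e)], leaving [p a] with the coefficient 2. *)
Lemma mixed_rigidity (p : V -> int -> F) :
  p e 0 = 0 ->
  (forall a b i j, (v a + v b) * (p a i - p b j)
                   = (v a - v b) * p (a + b) (i + j)) ->
  forall a i, p a i = (v a ^+ 2 - v a) / 2 * p (- e) 0.
Proof.
move=> pe0 pE.
have pe i : p e i = 0.
  have := pE e e i 0; rewrite pe0 ve subrr mul0r subr0 => /eqP.
  by rewrite mulf_eq0 -(natrD _ 1 1) pnatr_eq0 => /eqP.
have p0 j : p 0 j = 0.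
  have := pE e 0 0 j; rewrite addr0 !pe raddf0 ve mulr0 addr0 sub0r mul1r.
  by move=> /eqP; rewrite oppr_eq0 => /eqP.
have pi a i : p a i = p a 0.
  have [->|a0] := eqVneq a 0; first by rewrite !p0.
  have va0 : v a != 0 by rewrite -(raddf0 v) (inj_eq v_inj).
  have := pE a 0 0 i; rewrite p0 raddf0 addr0 !subr0 addr0 add0r.
  by move/(mulfI va0).
move=> a i; rewrite pi.
have h1 := pE a e 0 0; have h2 := pE (a + e) (- e) 0 0.
rewrite addr0 pe addrK !vD raddfN ve in h1 h2.
set q := p (a + e) 0 in h1 h2; set r := p a 0 in h1 h2 *.
set s := p (- e) 0 in h2 *.
have h : 2 * r = (v a ^+ 2 - v a) * s.
  apply/eqP; rewrite -subr_eq0; apply/eqP.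
  transitivity
    ((v a - 1) * ((v a + 1 - 1) * (q - s) - (v a + 1 - - 1) * r)
     + v a * ((v a + 1) * (r - 0) - (v a - 1) * q)); first by ring.
  by rewrite h1 h2 !subrr !mulr0 addr0.
have -> : r = 2 * r / 2 by field.
by rewrite h; field.
Qed.

Lemma heisenberg_rigidity (q : V -> int -> F) :
  (forall b c j k, v c * q b j = v b * q c k) ->
  forall b j, q b j = v b * q e 0.
Proof. by move=> qE b j; rewrite -(qE b e j 0) ve mul1r. Qed.

End Rigidity.

(** * Bilinear forms on the loop algebra, seen on the basis *)

Section BasisForms.
Variables (R : realType) (G : zmodClosed R[i]).
Implicit Types (a b d : hv_basis G) (u v w : loopHV G).

Lemma hv_bilinear_ext (p q : loopHV G -> loopHV G -> R[i]^o) :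
  (forall v, linear (p^~ v)) -> (forall u, linear (p u)) ->
  (forall v, linear (q^~ v)) -> (forall u, linear (q u)) ->
  (forall a b, p << a >> << b >> = q << a >> << b >>) ->
  forall u v, p u v = q u v.
Proof.
move=> pl pr ql qr pq u v; apply/eqP; rewrite -subr_eq0; apply/eqP.
have sub (r s : loopHV G -> R[i]^o) :
    linear r -> linear s -> linear (fun x => r x - s x).
  by move=> rl sl k x y; rewrite rl sl scalerBr opprD addrACA.
move: u; apply: malg_linear0 => [|a]; first exact: (sub (p^~ v) (q^~ v)).
move: v; apply: malg_linear0 => [|b]; first exact: sub.
by rewrite pq subrr.
Qed.

(** The value on [hv_bracket a b] of the linear form with values [g] on the
basis.  With it the Jacobi identity on basis vectors is an identity between
scalars that no longer mentions the free module. *)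
Definition bracket_value (g : hv_basis G -> R[i]^o) a b : R[i]^o :=
  match a, b with
  | Lb x i, Lb y j => (gam_val x - gam_val y) * g (Lb (x + y) (i + j))
  | Lb x i, Hb y j => - gam_val y * g (Hb (x + y) (i + j))
  | Hb x i, Lb y j => gam_val x * g (Hb (x + y) (i + j))
  | Hb _ _, Hb _ _ => 0
  end.

Lemma bracket_valueC (g : hv_basis G -> R[i]^o) a b :
  bracket_value g a b = - bracket_value g b a.
Proof.
case: a b => [x i|x i] [y j|y j] /=; last by rewrite oppr0.
all: rewrite (addrC y) (addrC j).
all: by move: (gam_val x) (gam_val y) (g _) => X Y F; ring.
Qed.

Lemma linear_hv_bracket (f : loopHV G -> R[i]^o) a b :
  linear f -> f (hv_bracket a b) = bracket_value (fun a => f << a >>) a b.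
Proof.
move=> fl; have fZ k u : f (k *: u) = k * f u.
  exact: (GRing.scalable_linear fl).
case: a b => [x i|x i] [y j|y j] /=; try exact: fZ.
by rewrite -(scale0r 0) fZ mul0r.
Qed.

Lemma hv_cocycle_on_basis (p : loopHV G -> loopHV G -> R[i]^o) :
  (forall v, linear (p^~ v)) -> (forall u, linear (p u)) ->
  (forall a b, p << a >> << b >> = - p << b >> << a >>) ->
  (forall a b d, bracket_value (fun e => p << a >> << e >>) b d
                 + bracket_value (fun e => p << b >> << e >>) d a
                 + bracket_value (fun e => p << d >> << e >>) a b = 0) ->
  is_cocycle p.
Proof.
move=> pl pr pC pJ; split=> //.
  apply: hv_bilinear_ext => // [v|u] k x y.
  - by rewrite pr opprD scalerN.
  - by rewrite pl opprD scalerN.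
have ll k u v w : hv_lie (k *: u + v) w = k *: hv_lie u w + hv_lie v w.
  exact: hv_lie_linearl.
have lr k u v w : hv_lie w (k *: u + v) = k *: hv_lie w u + hv_lie w v.
  exact: hv_lie_linearr.
have pll k u v w : p (k *: u + v) w = k *: p u w + p v w by exact: pl.
have plr k u v w : p w (k *: u + v) = k *: p w u + p w v by exact: pr.
have aca (k : R[i]) (x y z x' y' z' : R[i]^o) :
    (k *: x + x') + (k *: y + y') + (k *: z + z') =
    k *: (x + y + z) + (x' + y' + z').
  by rewrite (addrACA (k *: x)) [LHS]addrACA !scalerDr.
move=> x y z; change (p x (hv_lie y z) + p y (hv_lie z x) + p z (hv_lie x y) = 0).
move: x; apply: malg_linear0 => [k u v|a].
  by rewrite ll lr pll !plr aca.
move: y; apply: malg_linear0 => [k u v|b].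
  by rewrite ll lr pll !plr aca.
move: z; apply: malg_linear0 => [k u v|d].
  by rewrite ll lr pll !plr aca.
rewrite !hv_lieU (linear_hv_bracket b d (pr _)) (linear_hv_bracket d a (pr _)).
by rewrite (linear_hv_bracket a b (pr _)) pJ.
Qed.

Lemma cocycle_jacobi_basis (p : loopHV G -> loopHV G -> R[i]^o) :
  is_cocycle p -> forall a b d,
  bracket_value (fun e => p << a >> << e >>) b d
  + bracket_value (fun e => p << b >> << e >>) d a
  + bracket_value (fun e => p << d >> << e >>) a b = 0.
Proof.
move=> [_ pr _ pJ] a b d.
have {}pJ u v w :
  p u (hv_lie v w) + p v (hv_lie w u) + p w (hv_lie u v) = 0 := pJ u v w.
rewrite -(linear_hv_bracket b d (pr _)) -(linear_hv_bracket d a (pr _)).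
by rewrite -(linear_hv_bracket a b (pr _)) -!hv_lieU pJ.
Qed.

Lemma coboundary_cocycle (f : loopHV G -> R[i]^o) :
  linear f -> is_cocycle (fun u v => f (hv_lie u v)).
Proof.
move=> fl; have fD u v : f (u + v) = f u + f v.
  by rewrite -[u]scale1r fl !scale1r.
have fZ k u : f (k *: u) = k *: f u by exact: (GRing.scalable_linear fl).
split.
- by move=> v k x y; rewrite hv_lie_linearl fl.
- by move=> u k x y; rewrite hv_lie_linearr fl.
- by move=> u v; rewrite hv_lieC -scaleN1r fZ scaleN1r.
- move=> x y z; rewrite -!fD hv_jacobi.
  by rewrite -(scale0r 0) fZ scale0r.
Qed.

Lemma H2_class_eqP (p q : C2 (loopHV G)) :
  H2_class p = H2_class q <->
  exists2 f : loopHV G -> R[i]^o, linear f &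
    forall u v, p u v = q u v + f (hv_lie u v).
Proof.
split=> [/H2_classE/asboolP[f fl fE]|[f fl fE]].
  exists f => // u v; rewrite -[f _]fE.
  change (p u v = q u v + (p u v - q u v)).
  by rewrite addrC subrK.
apply/H2_classE/asboolP; exists f => // u v.
change (p u v - q u v = f (hv_lie u v)).
by rewrite fE addrC addKr.
Qed.

(** A bilinear extension whose second argument is a dummy. *)
Definition linear_extension (f : hv_basis G -> R[i]^o) (u : loopHV G) : R[i]^o :=
  bilin_ext (fun a _ => f a) u << Lb 0 0 >>.

Lemma linear_extension_linear f : linear (linear_extension f).
Proof. exact: bilin_ext_linearl. Qed.

Lemma linear_extensionU f a : linear_extension f << a >> = f a.
Proof. exact: bilin_extU. Qed.

End BasisForms.

(** * The cocycles [phi_sum c] *)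

Section PhiSum.
Variables (R : realType) (G : zmodClosed R[i]).
Implicit Types (a b d : hv_basis G) (u v w : loopHV G)
  (c : int * 'I_3 -> R[i]^o).

Definition loop_degree a : int := match a with Lb _ i | Hb _ i => i end.

Lemma phi_basis_degree k x a b :
  k != loop_degree a + loop_degree b -> phi_basis k x a b = 0.
Proof.
rewrite /phi_basis; case: x => -[|[|[|//]]] ? /=.
all: case: a b => [y i|y i] [z j|z j] //=; rewrite eq_sym => /negPf h.
all: by rewrite /delta ?(addrC j i) h ?(mulr0, mul0r, oppr0).
Qed.

(** A finite set of indices outside which [phi k x u v] vanishes: [k] has to be
the total degree of a pair of basis vectors occurring in [u] and [v]. *)
Definition degree_support u v : {fset int * 'I_3} :=
  let ks := [seq loop_degree a + loop_degree b | a <- msupp u, b <- msupp v] in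
  seq_fset tt [seq (k, x) | k <- ks, x <- enum 'I_3].

Lemma degree_supportP u v a b k x :
  a \in msupp u -> b \in msupp v -> (k, x) \notin degree_support u v ->
  phi_basis k x a b = 0.
Proof.
move=> au bv kx; apply: phi_basis_degree; apply: contraNneq kx => ->.
rewrite seq_fsetE; apply/allpairsP; exists (loop_degree a + loop_degree b, x).
rewrite mem_enum; split=> //=; apply/allpairsP; by exists (a, b).
Qed.

Lemma phi_degree_support u v k x :
  (k, x) \notin degree_support u v -> phi k x u v = 0.
Proof.
move=> kx; rewrite /phi /bilin_ext big_seq big1 // => a au.
rewrite big_seq big1 // => b bv.
by rewrite (degree_supportP au bv kx) scaler0.
Qed.

Lemma phi_finite_support u v :
  finite_set [set kx : int * 'I_3 | phi kx.1 kx.2 u v != 0]%classic.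
Proof.
apply: (@sub_finite_set _ _ [set` degree_support u v]%classic) => //.
move=> [k x] /= h; apply: contraNT h => /phi_degree_support -> //.
Qed.

Lemma phi_sum_fset c u v :
  phi_sum c u v = \sum_(kx <- degree_support u v) c kx * phi kx.1 kx.2 u v.
Proof.
by apply: fsbigTE => -[k x] /phi_degree_support ->; rewrite mulr0.
Qed.

Definition phi_sum_basis c a b : R[i]^o :=
  \sum_(kx \in [set: int * 'I_3]) c kx * phi_basis kx.1 kx.2 a b.

(** The infinite sum may be exchanged with the finite bilinear expansion of [u]
and [v], as all the sums involved run over the same finite support. *)
Lemma phi_sumE c : @phi_sum R G c = bilin_ext (phi_sum_basis c).
Proof.
apply: funext => u; apply: funext => v; rewrite phi_sum_fset.
rewrite /bilin_ext; under eq_bigr do rewrite /phi /bilin_ext mulr_sumr.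
rewrite exchange_big /= big_seq [RHS]big_seq; apply: eq_bigr => a au.
under eq_bigr do rewrite mulr_sumr.
rewrite exchange_big /= big_seq [RHS]big_seq; apply: eq_bigr => b bv.
rewrite /phi_sum_basis (fsbigTE (degree_support u v)); last first.
  by move=> [k x] /(degree_supportP au bv) ->; rewrite mulr0.
rewrite scaler_sumr; apply: eq_bigr => kx _.
by rewrite -scalerAr.
Qed.

Lemma phi_sum_basis_single c a b (x0 : 'I_3) :
  (forall k x, x != x0 -> phi_basis k x a b = 0) ->
  phi_sum_basis c a b = c (loop_degree a + loop_degree b, x0)
                        * phi_basis (loop_degree a + loop_degree b) x0 a b.
Proof.
move=> h; set kx0 := (_, x0).
rewrite /phi_sum_basis (fsbigTE (seq_fset tt [:: kx0])) => [|[k x]].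
  by rewrite (perm_big _ (seq_fset_perm tt _)) //= big_seq1.
rewrite seq_fsetE inE xpair_eqE negb_and => /orP[/phi_basis_degree|/h] -> /=.
  by rewrite mulr0.
by rewrite mulr0.
Qed.

Lemma phi_sum_basisLL c x i y j :
  phi_sum_basis c (Lb x i) (Lb y j) =
  delta R (x + y) 0 * (c (i + j, 0) * ((gam_val x ^+ 3 - gam_val x) / 12)).
Proof.
rewrite (@phi_sum_basis_single c _ _ 0) => [|k]; last by case=> -[|[|[|//]]].
by rewrite /phi_basis /= [X in _ * X * _]/delta eqxx mulr1 mulrCA.
Qed.

Lemma phi_sum_basisLH c x i y j :
  phi_sum_basis c (Lb x i) (Hb y j) =
  delta R (x + y) 0 * (c (i + j, 1) * (gam_val x ^+ 2 - gam_val x)).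
Proof.
rewrite (@phi_sum_basis_single c _ _ 1) => [|k]; last by case=> -[|[|[|//]]].
by rewrite /phi_basis /= [X in _ * X * _]/delta eqxx mulr1 mulrCA.
Qed.

Lemma phi_sum_basisHL c x i y j :
  phi_sum_basis c (Hb x i) (Lb y j) =
  - (delta R (x + y) 0 * (c (i + j, 1) * (gam_val y ^+ 2 - gam_val y))).
Proof.
rewrite (@phi_sum_basis_single c _ _ 1) => [|k]; last by case=> -[|[|[|//]]].
rewrite /phi_basis /= [X in _ * X * _]/delta (addrC j) eqxx mulr1 (addrC y).
by rewrite mulrN mulrCA.
Qed.

Lemma phi_sum_basisHH c x i y j :
  phi_sum_basis c (Hb x i) (Hb y j) =
  delta R (x + y) 0 * (c (i + j, 2) * gam_val x).
Proof.
rewrite (@phi_sum_basis_single c _ _ 2) => [|k]; last by case=> -[|[|[|//]]].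
by rewrite /phi_basis /= [X in _ * X * _]/delta eqxx mulr1 mulrCA.
Qed.

Definition phi_sum_basisE :=
  (phi_sum_basisLL, phi_sum_basisLH, phi_sum_basisHL, phi_sum_basisHH).

Lemma phi_sum_linearl c v : linear (phi_sum c ^~ v).
Proof. by rewrite phi_sumE; apply: bilin_ext_linearl. Qed.

Lemma phi_sum_linearr c u : linear (phi_sum c u).
Proof. by rewrite phi_sumE; apply: bilin_ext_linearr. Qed.

Lemma phi_sumU c a b : phi_sum c << a >> << b >> = phi_sum_basis c a b.
Proof. by rewrite phi_sumE bilin_extU. Qed.

Lemma phi_sum_basisC c a b : phi_sum_basis c a b = - phi_sum_basis c b a.
Proof.
case: a b => [x i|x i] [y j|y j]; rewrite !phi_sum_basisE.
all: rewrite (addrC y x) (addrC j i) /delta; case: eqVneq => [xy|_].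
all: try by rewrite !mul0r ?oppr0.
all: have yE : gam_val y = - gam_val x by rewrite -(addr0_eq xy).
all: rewrite ?yE; move: (gam_val x) (c _) => X C; ring.
Qed.

(** All three terms carry the same total weight and total degree, hence the same
delta and the same coefficient of [c]. *)
Lemma phi_sum_jacobi c a b d :
  bracket_value (phi_sum_basis c a) b d + bracket_value (phi_sum_basis c b) d a
    + bracket_value (phi_sum_basis c d) a b = 0.
Proof.
have rot (M : zmodType) (p q r : M) :
    (q + (r + p) = p + (q + r)) * (r + (p + q) = p + (q + r)).
  by split; [rewrite addrA addrC | rewrite addrC addrA].
have [gx gy] := (rot (gam G), rot int).
case: a b d => [x i|x i] [y j|y j] [z k|z k]; rewrite /bracket_value.
all: rewrite ?phi_sum_basisE.
all: rewrite ?(gx x y z) ?(gy i j k) /delta; try case: eqVneq => [xyz|_].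
all: rewrite ?(mul0r, mulr0, oppr0, addr0) //.
all: have zE : gam_val z = - (gam_val x + gam_val y)
  by rewrite addrA in xyz; rewrite -(addr0_eq xyz).
all: have vD (p q : gam G) : gam_val (p + q) = gam_val p + gam_val q by [].
all: rewrite ?vD ?zE; move: (gam_val x) (gam_val y) => X Y.
all: move: (c _) => C.
all: by ring.
Qed.

Lemma phi_sum_cocycle c : is_cocycle (@phi_sum R G c).
Proof.
apply: hv_cocycle_on_basis.
- exact: phi_sum_linearl.
- exact: phi_sum_linearr.
- by move=> a b; rewrite !phi_sumU phi_sum_basisC.
- move=> a b d; rewrite -(phi_sum_jacobi c a b d).
  by congr (_ + _ + _); congr bracket_value; apply: funext => e; exact: phi_sumU.
Qed.

(** This makes the cocycle property of a single [phi k x] a special case of that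
of [phi_sum c]. *)
Lemma phi_sum_indicator k x :
  phi k x = @phi_sum R G (fun kx => (kx == (k, x))%:R).
Proof.
apply: funext => u; apply: funext => v; rewrite /phi_sum.
rewrite (fsbigTE (seq_fset tt [:: (k, x)])) => [|kx].
  by rewrite (perm_big _ (seq_fset_perm tt _)) //= big_seq1 eqxx mul1r.
by rewrite seq_fsetE inE => /negPf ->; rewrite mul0r.
Qed.

Lemma phi_sum_linear : linear (@phi_sum R G).
Proof.
move=> k c d; apply: funext => u; apply: funext => v.
change (phi_sum (k *: c + d) u v = k * phi_sum c u v + phi_sum d u v).
rewrite !phi_sum_fset mulr_sumr -big_split; apply: eq_bigr => kx _ /=.
by rewrite mulrA -mulrDl.
Qed.

End PhiSum.

(** * Normalized cocycles *)

Section Normalized.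
Variables (R : realType) (G : zmodClosed R[i]) (e : gam G).
Hypothesis e1 : gam_val e = 1.
Implicit Types (a b d : hv_basis G) (x y z : gam G) (i j k n : int).
(* P stands for the values of a cocycle on pairs of basis vectors. *)
Variable P : hv_basis G -> hv_basis G -> R[i]^o.
Hypotheses (PC : forall a b, P a b = - P b a)
  (PJ : forall a b d,
     bracket_value (P a) b d + bracket_value (P b) d a
     + bracket_value (P d) a b = 0).
Hypotheses (P00L : forall x k, x != 0 -> P (Lb 0 0) (Lb x k) = 0)
  (P00H : forall x k, x != 0 -> P (Lb 0 0) (Hb x k) = 0)
  (PeL : forall k, P (Lb e 0) (Lb (- e) k) = 0)
  (PeH : forall k, P (Lb e 0) (Hb (- e) k) = 0).

Let vD x y : gam_val (x + y) = gam_val x + gam_val y. Proof. by []. Qed.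
Let vN x : gam_val (- x) = - gam_val x. Proof. by []. Qed.

Definition weight a : gam G := match a with Lb x _ | Hb x _ => x end.

(** In weight zero, which the normalization does not cover directly, the vector
is a multiple of a bracket of vectors of weights [e] and [- e]; the other two
terms of the Jacobi identity are then values of [P] on that pair. *)
Lemma normalized_L00 a : P (Lb 0 0) a = 0.
Proof.
case: a => [x k|x k]; (have [->|x0] := eqVneq x 0; last by auto).
- have := PJ (Lb 0 0) (Lb e 0) (Lb (- e) k); rewrite /bracket_value.
  rewrite subrr !addr0 !add0r (PC _ (Lb e 0)) PeL oppr0 !mulr0 !addr0.
  rewrite vN e1 => /eqP; rewrite mulf_eq0 opprK -(natrD _ 1 1) pnatr_eq0 /=.
  by move/eqP.
- have := PJ (Lb 0 0) (Lb e 0) (Hb (- e) k); rewrite /bracket_value.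
  rewrite subrr !addr0 !add0r (PC _ (Lb e 0)) PeH oppr0 !mulr0 !addr0.
  by rewrite vN e1 opprK mul1r.
Qed.

(** [L_(0,0)] acts on a basis vector by minus its weight, and [P (Lb 0 0)]
vanishes, so the Jacobi identity with [L_(0,0)] says that the total weight times
[P a b] is zero. *)
Lemma normalized_weight a b : weight a + weight b != 0 -> P a b = 0.
Proof.
move=> ab0; have : gam_val (weight a + weight b) * P a b = 0.
  have E (g : hv_basis G -> R[i]^o) d : bracket_value g d (Lb 0 0)
      = gam_val (weight d) * g d.
    by case: d => x k; rewrite /= !addr0 // subr0.
  have E' (g : hv_basis G -> R[i]^o) d : bracket_value g (Lb 0 0) d
      = - gam_val (weight d) * g d.
    by case: d => x k; rewrite /= !add0r // sub0r.
  have E0 d d' : bracket_value (P (Lb 0 0)) d d' = 0.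
    by case: d d' => [? ?|? ?] [? ?|? ?] //=; rewrite normalized_L00 mulr0.
  have := PJ (Lb 0 0) a b; rewrite E0 E E' add0r (PC b a).
  by rewrite mulrNN addrC -mulrDl.
move/eqP; rewrite mulf_eq0 => /orP[h|/eqP //]; case/negP: ab0.
by rewrite -(inj_eq val_inj).
Qed.

Let val_additive : {additive gam G -> R[i]} := val.

(** In the next three lemmas [n] is the total loop degree, which the Jacobi
identity preserves; they instantiate the functional equations above. *)
Lemma normalized_LL x i n :
  P (Lb x i) (Lb (- x) (n - i))
  = (gam_val x ^+ 3 - gam_val x) / 6 * P (Lb (e + e) 0) (Lb (- (e + e)) n).
Proof.
rewrite -[X in Lb (- (e + e)) X]subr0.
apply: (@virasoro_rigidity _ _ val_additive e val_inj e1
          (fun x i => P (Lb x i) (Lb (- x) (n - i)))) => //.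
move=> x1 y i1 j.
have := PJ (Lb x1 i1) (Lb y j) (Lb (- (x1 + y)) (n - (i1 + j))).
rewrite /bracket_value.
have -> : y - (x1 + y) = - x1 by rewrite opprD addrCA subrr addr0.
have -> : - (x1 + y) + x1 = - y by rewrite addrC opprD addrA subrr add0r.
have -> : j + (n - (i1 + j)) = n - i1 by ring.
have -> : n - (i1 + j) + i1 = n - j by ring.
rewrite (PC _ (Lb (x1 + y) _)) vN vD.
change (val_additive x1) with (gam_val x1).
change (val_additive y) with (gam_val y).
move: (gam_val x1) (gam_val y) (P _ _) (P _ _) (P _ _) => X Y p q r h.
apply/eqP; rewrite -subr_eq0 -[X in _ == X]h; apply/eqP; ring.
Qed.

Lemma normalized_LH x i n :
  P (Lb x i) (Hb (- x) (n - i))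
  = (gam_val x ^+ 2 - gam_val x) / 2 * P (Lb (- e) 0) (Hb e n).
Proof.
rewrite -[X in Hb e X]subr0 -[X in Hb X (n - 0)]opprK.
apply: (@mixed_rigidity _ _ val_additive e val_inj e1
          (fun x i => P (Lb x i) (Hb (- x) (n - i)))) => //.
move=> x1 y i1 j.
have := PJ (Lb x1 i1) (Lb y j) (Hb (- (x1 + y)) (n - (i1 + j))).
rewrite /bracket_value.
have -> : y - (x1 + y) = - x1 by rewrite opprD addrCA subrr addr0.
have -> : - (x1 + y) + x1 = - y by rewrite addrC opprD addrA subrr add0r.
have -> : j + (n - (i1 + j)) = n - i1 by ring.
have -> : n - (i1 + j) + i1 = n - j by ring.
rewrite (PC _ (Lb (x1 + y) _)) vN vD.
change (val_additive x1) with (gam_val x1).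
change (val_additive y) with (gam_val y).
move: (gam_val x1) (gam_val y) (P _ _) (P _ _) (P _ _) => X Y p q r h.
apply/eqP; rewrite -subr_eq0 -[X in _ == X]h; apply/eqP; ring.
Qed.

Lemma normalized_HH x i n :
  P (Hb x i) (Hb (- x) (n - i)) = gam_val x * P (Hb e 0) (Hb (- e) n).
Proof.
rewrite -[X in Hb (- e) X]subr0.
apply: (@heisenberg_rigidity _ _ val_additive e e1
          (fun x i => P (Hb x i) (Hb (- x) (n - i)))) => // y z j k.
have := PJ (Lb (- (y + z)) (n - (j + k))) (Hb y j) (Hb z k).
rewrite /bracket_value.
have -> : z - (y + z) = - y by rewrite opprD addrCA subrr addr0.
have -> : - (y + z) + y = - z by rewrite addrC opprD addrA subrr add0r.
have -> : k + (n - (j + k)) = n - j by ring.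
have -> : n - (j + k) + j = n - k by ring.
by rewrite add0r mulNr => /eqP; rewrite subr_eq0 => /eqP.
Qed.

(** The factors 2 and 1/2 come from [(2 ^ 3 - 2) / 12 = 1 / 2] and
[(- 1) ^ 2 - (- 1) = 2], the values of the first two families on the pairs
used. *)
Definition phi_coordinates (kx : int * 'I_3) : R[i]^o :=
  match val kx.2 with
  | 0 => 2 * P (Lb (e + e) 0) (Lb (- (e + e)) kx.1)
  | 1 => P (Lb (- e) 0) (Hb e kx.1) / 2
  | _ => P (Hb e 0) (Hb (- e) kx.1)
  end.

Lemma normalizedE a b : P a b = phi_sum_basis phi_coordinates a b.
Proof.
have [ab|ab] := eqVneq (weight a + weight b) 0; last first.
  rewrite normalized_weight //; move: ab.
  by case: a b => [x i|x i] [y j|y j] /negPf ab;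
    rewrite phi_sum_basisE /delta ?[y + x]addrC ab mul0r ?oppr0.
(* Puts a pair of degrees into the form i, n - i with n = i + j. *)
have jE i j : j = i + j - i by rewrite addrC addKr.
have LH x i y j : x + y = 0 -> P (Lb x i) (Hb y j)
    = phi_sum_basis phi_coordinates (Lb x i) (Hb y j).
  move=> xy; rewrite phi_sum_basisE /delta xy eqxx mul1r.
  rewrite -(addr0_eq xy) {1}(jE i j) normalized_LH.
  rewrite /phi_coordinates /=.
  move: (gam_val x) (P _ _) => X p; ring.
case: a b ab => [x i|x i] [y j|y j] /= xy.
- rewrite phi_sum_basisE /delta xy eqxx mul1r.
  rewrite -(addr0_eq xy) {1}(jE i j) normalized_LL.
  rewrite /phi_coordinates /=.
  by move: (gam_val x) (P _ _) => X p; field.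
- exact: LH.
- by rewrite PC phi_sum_basisC; congr (- _); apply: LH; rewrite addrC.
- rewrite phi_sum_basisE /delta xy eqxx mul1r.
  rewrite -(addr0_eq xy) {1}(jE i j) normalized_HH.
  by rewrite /phi_coordinates /= mulrC.
Qed.

End Normalized.

(** * Classification *)

Section Classification.
Variables (R : realType) (G : zmodClosed R[i]) (e : gam G).
Hypothesis e1 : gam_val e = 1.
Implicit Types (a b d : hv_basis G) (x y z : gam G) (i j k n : int).

Let v_neq0 x : x != 0 -> gam_val x != 0.
Proof. by rewrite -(inj_eq val_inj). Qed.

(** The linear form whose coboundary agrees with [p] on the pairs
[L_(0,0), X_(x,k)] with [x != 0] and [L_(e,0), X_(- e,k)], for [X] either [L] or
[H]; it is obtained by solving [p a b = f (hv_bracket a b)] on those pairs. *)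
Definition normalizer (p : hv_basis G -> hv_basis G -> R[i]^o) a : R[i]^o :=
  match a with
  | Lb x k => if x == 0 then p (Lb e 0) (Lb (- e) k) / 2
              else p (Lb 0 0) (Lb x k) / - gam_val x
  | Hb x k => if x == 0 then p (Lb e 0) (Hb (- e) k)
              else p (Lb 0 0) (Hb x k) / - gam_val x
  end.

(** Adding the coboundary of [- f0], with [f0] the normalizer of [psi], gives a
normalized cocycle, to which [normalizedE] applies. *)
Lemma cocycle_cohomologous_phi_sum (psi : loopHV G -> loopHV G -> R[i]^o) :
  is_cocycle psi ->
  exists c, exists2 f : loopHV G -> R[i]^o, linear f &
    forall u v, phi_sum c u v = psi u v + f (hv_lie u v).
Proof.
move=> psiP; have [pl pr pC _] := psiP.
pose f0 := normalizer (fun a b => psi << a >> << b >>).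
pose P a b : R[i]^o := psi << a >> << b >> - bracket_value f0 a b.
have cobP := coboundary_cocycle (linear_extension_linear f0).
have cobU a b : linear_extension f0 (hv_lie << a >> << b >>) = bracket_value f0 a b.
  rewrite hv_lieU (linear_hv_bracket _ _ (linear_extension_linear f0)).
  by congr bracket_value; apply: funext => d; rewrite linear_extensionU.
have bvB (g h : hv_basis G -> R[i]^o) a b :
    bracket_value (fun d => g d - h d) a b = bracket_value g a b - bracket_value h a b.
  by case: a b => [x i|x i] [y j|y j] /=; rewrite ?mulrBr ?subr0.
have bv_cob a b d : bracket_value (bracket_value f0 a) b d
    = bracket_value (fun d => linear_extension f0 (hv_lie << a >> << d >>)) b d.
  by congr bracket_value; apply: funext => d'; rewrite cobU.
have subD3 (a1 a2 a3 b1 b2 b3 : R[i]^o) :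
    (a1 - b1) + (a2 - b2) + (a3 - b3) = (a1 + a2 + a3) - (b1 + b2 + b3).
  by rewrite !opprD [X in X + _ = _]addrACA [LHS]addrACA.
exists (phi_coordinates e P), (fun u => - linear_extension f0 u).
  by move=> k u v; rewrite linear_extension_linear opprD scalerN.
apply: (hv_bilinear_ext (p := phi_sum _)
  (q := fun u v => psi u v + - linear_extension f0 (hv_lie u v))).
- exact: phi_sum_linearl.
- exact: phi_sum_linearr.
- move=> v k u w; rewrite pl hv_lie_linearl linear_extension_linear.
  by rewrite opprD scalerDr scalerN addrACA.
- move=> v k u w; rewrite pr hv_lie_linearr linear_extension_linear.
  by rewrite opprD scalerDr scalerN addrACA.
move=> a b; rewrite phi_sumU cobU -[RHS]/(P a b); apply/esym/normalizedE => //.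
- move=> a' b'; rewrite /P (pC << a' >>) (bracket_valueC _ a').
  by move: (psi _ _) (bracket_value _ _ _) => s t; rewrite opprD.
- move=> a' b' d'; rewrite /P !bvB !bv_cob.
  rewrite subD3 (cocycle_jacobi_basis psiP) (cocycle_jacobi_basis cobP).
  exact: subr0.
- move=> x k x0; rewrite /P /f0 /= !add0r (negPf x0).
  rewrite mulrC divfK ?subrr // oppr_eq0; exact: v_neq0.
- move=> x k x0; rewrite /P /f0 /= !add0r (negPf x0).
  rewrite mulrC divfK ?subrr // oppr_eq0; exact: v_neq0.
- move=> k; rewrite /P /f0 /= subrr add0r eqxx e1 opprK.
  by rewrite mulrC divfK ?subrr // pnatr_eq0.
- by move=> k; rewrite /P /f0 /= subrr add0r eqxx e1 opprK mul1r subrr.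
Qed.

(** The pairs of weights [(e, - e)] determine [g] in weight zero, because the
first two families vanish on them; the pairs [(e + e, - (e + e))] and [(- e, e)]
then give the coefficients.  For the third family the bracket itself is zero. *)
Lemma phi_sum_basis_inj (c d : int * 'I_3 -> R[i]^o) g :
  (forall a b, phi_sum_basis c a b = phi_sum_basis d a b + bracket_value g a b) ->
  c = d.
Proof.
move=> cd; apply: funext => -[k x].
have vD y z : gam_val (y + z) = gam_val y + gam_val z by [].
have vN y : gam_val (- y) = - gam_val y by [].
have LL := cd (Lb (e + e) 0) (Lb (- (e + e)) k).
have LL0 := cd (Lb e 0) (Lb (- e) k).
have LH := cd (Lb (- e) 0) (Hb e k).
have LH0 := cd (Lb e 0) (Hb (- e) k).
have HH := cd (Hb e 0) (Hb (- e) k).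
rewrite !phi_sum_basisE /bracket_value /delta ?addrN ?addNr ?add0r eqxx
  ?vN ?vD ?e1 !mul1r in LL LL0 LH LH0 HH.
have [->|->|->] : [\/ x = 0, x = 1 | x = 2].
  by case: x => -[|[|[|//]]] ltx; [apply: Or31|apply: Or32|apply: Or33];
    apply: val_inj.
- move: LL LL0; move: (c _) (d _) (g _) => C D E LL LL0.
  have E0 : E = 0.
    transitivity ((D * ((1 ^+ 3 - 1) / 12) + (1 - -1) * E) / 2).
      by field.
    by rewrite -LL0; field.
  transitivity (2 * (C * (((1 + 1) ^+ 3 - (1 + 1)) / 12))).
    by field.
  by rewrite LL E0; field.
- move: LH LH0; move: (c _) (d _) (g _) => C D E LH LH0.
  have E0 : E = 0.
    transitivity (D * (1 ^+ 2 - 1) + - (-1) * E); first by ring.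
    by rewrite -LH0; ring.
  transitivity (C * ((-1) ^+ 2 - -1) / 2); first by field.
  by rewrite LH E0; field.
- by move: HH; rewrite !mulr1 addr0.
Qed.

End Classification.

Theorem theorem1 (R : realType) (G : zmodClosed R[i]) (one_G : 1 \in G) :
  (forall u v : loopHV G,
     finite_set [set kx : int * 'I_3 | phi kx.1 kx.2 u v != 0]%classic) /\
  exists (phiP : forall (k : int) (x : 'I_3), is_cocycle (@phi R G k x))
         (sumP : forall c : int * 'I_3 -> R[i]^o, is_cocycle (@phi_sum R G c)),
    let Phi (c : int * 'I_3 -> R[i]^o) : H2 (loopHV G) :=
      H2_class (cocycle (sumP c)) in
    [/\ linear Phi, bijective Phi
      & forall (k : int) (x : 'I_3),
          Phi (fun kx => (kx == (k, x))%:R) = H2_class (cocycle (phiP k x))].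
Proof.
split; first exact: phi_finite_support.
have phiP k x : is_cocycle (@phi R G k x).
  by rewrite phi_sum_indicator; apply: phi_sum_cocycle.
exists phiP, (@phi_sum_cocycle R G) => Phi.
have e1 : gam_val (Gam one_G) = 1 by [].
split.
- move=> k c d; rewrite /Phi.
  rewrite -[k *: H2_class _]/(H2_scale k (H2_class _)) H2_scale_class.
  rewrite -H2_classD; congr H2_class.
  by apply: val_inj; exact: phi_sum_linear.
- rewrite -setTT_bijective; split => // [c d _ _|q _].
    move=> /H2_class_eqP[f fl fE].
    apply: (phi_sum_basis_inj e1 (g := fun a => f << a >>)) => a b.
    by rewrite -(linear_hv_bracket a b fl) -hv_lieU -!phi_sumU; apply: fE.
  have [c [f fl fE]] := cocycle_cohomologous_phi_sum e1 (asboolW (C2_valP (repr q))).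
  exists c => //; rewrite -[RHS]H2_classK; apply/H2_class_eqP.
  by exists f.
- move=> k x; congr H2_class; apply: val_inj => /=.
  by rewrite phi_sum_indicator.
Qed.
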